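(* Let $n\ge1$, $\alpha\ge1$, let $(Q_1,\ldots,Q_n)$ be an $\alpha$-conditioned $n$-tuple of positive definite real symmetric $n\times n$ matrices, and let $(P_1,\ldots,P_n)$ be a doubly stochastic $n$-tuple of positive definite matrices obtained from $(Q_1,\ldots,Q_n)$ by scaling, i.e. there exist an invertible real $n\times n$ matrix $T$ and reals $\tau_1,\ldots,\tau_n>0$ with $P_i=\tau_i T^{*}Q_iT$ for $i=1,\ldots,n$ ($T^*$ the transpose). Then $$D(P_1,\ldots,P_n)\ \le\ n^{\alpha^4}e^{-(n-1)}.$$
   Context: For real symmetric $n\times n$ matrices $Q_1,\ldots,Q_n$, the mixed discriminant is $D(Q_1,\ldots,Q_n)=\frac{\partial^n}{\partial t_1\cdots\partial t_n}\det(t_1Q_1+\cdots+t_nQ_n)$. An $n$-tuple $(Q_1,\ldots,Q_n)$ of positive semidefinite $n\times n$ matrices is doubly stochastic if $Q_1+\cdots+Q_n=I$ and $\operatorname{tr}Q_1=\cdots=\operatorname{tr}Q_n=1$. For $\alpha\ge1$, an $n$-tuple of positive definite matrices is $\alpha$-conditioned if $\lambda_{\max}(Q_i)\le\alpha\,\lambda_{\min}(Q_j)$ for all $1\le i,j\le n$ (including $i=j$). *)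

(* Defs.v *)
(* MathComp matrices over the Stdlib real numbers R.
   We equip Stdlib's R with the MathComp eqType/choiceType/comNzRing
   structures (as mathcomp-analysis' Rstruct does) so that MathComp
   matrices, determinants, traces and scaling can be used, while
   exp / Rpower / derivatives come from Stdlib Reals. *)
From HB Require Import structures.
From Stdlib Require Import Reals ClassicalEpsilon FunctionalExtensionality.
From mathcomp Require Import all_boot all_order all_algebra.

Set Implicit Arguments.
Unset Strict Implicit.
Unset Printing Implicit Defensive.

Import GRing.Theory.

Definition R_eqb (x y : R) : bool := if Req_EM_T x y then true else false.

Lemma R_eqP : Equality.axiom R_eqb.
Proof. move=> x y; rewrite /R_eqb; case: Req_EM_T => H; by constructor. Qed.

HB.instance Definition _ := hasDecEq.Build R R_eqP.

Definition R_find (P : pred R) (_ : nat) : option R :=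
  match excluded_middle_informative (exists x, P x) with
  | left H => Some (proj1_sig (constructive_indefinite_description _ H))
  | right _ => None
  end.

Lemma R_find_correct P n x : R_find P n = Some x -> P x.
Proof.
rewrite /R_find; case: excluded_middle_informative => // H [<-].
exact: proj2_sig (constructive_indefinite_description _ H).
Qed.

Lemma R_find_complete (P : pred R) : (exists x, P x) -> exists n, R_find P n.
Proof. by move=> H; exists 0%N; rewrite /R_find; case: excluded_middle_informative. Qed.

Lemma R_find_ext (P Q : pred R) : P =1 Q -> R_find P =1 R_find Q.
Proof.
move=> PQ n; have -> : P = Q by apply: functional_extensionality.
by [].
Qed.

HB.instance Definition _ :=
  hasChoice.Build R R_find_correct R_find_complete R_find_ext.

Lemma R_addA : ssrfun.associative Rplus. Proof. by move=> x y z; rewrite Rplus_assoc. Qed.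
Lemma R_addC : ssrfun.commutative Rplus. Proof. exact: Rplus_comm. Qed.
Lemma R_add0 : ssrfun.left_id R0 Rplus. Proof. exact: Rplus_0_l. Qed.
Lemma R_addN : ssrfun.left_inverse R0 Ropp Rplus. Proof. exact: Rplus_opp_l. Qed.

HB.instance Definition _ := GRing.isZmodule.Build R R_addA R_addC R_add0 R_addN.

Lemma R_mulA : ssrfun.associative Rmult. Proof. by move=> x y z; rewrite Rmult_assoc. Qed.
Lemma R_mulC : ssrfun.commutative Rmult. Proof. exact: Rmult_comm. Qed.
Lemma R_mul1 : ssrfun.left_id R1 Rmult. Proof. exact: Rmult_1_l. Qed.
Lemma R_mulDl : ssrfun.left_distributive Rmult Rplus.
Proof. by move=> x y z; rewrite Rmult_plus_distr_r. Qed.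
Lemma R_one_neq0 : R1 != R0.
Proof. by apply/eqP; exact: R1_neq_R0. Qed.

HB.instance Definition _ :=
  GRing.Zmodule_isComNzRing.Build R R_mulA R_mulC R_mul1 R_mulDl R_one_neq0.


Lemma R_mulVf (x : R) : x != GRing.zero -> Rmult (Rinv x) x = R1.
Proof. by move/eqP=> H; exact: Rinv_l. Qed.
Lemma R_inv0 : Rinv R0 = R0.
Proof. exact: Rinv_0. Qed.

HB.instance Definition _ := GRing.ComNzRing_isField.Build R R_mulVf R_inv0.

Local Open Scope ring_scope.

Definition posdef (n : nat) (A : 'M[R]_n) : Prop :=
  A^T = A /\ forall v : 'cV[R]_n, v <> 0 -> Rlt R0 ((v^T *m A *m v) ord0 ord0).

Definition possemidef (n : nat) (A : 'M[R]_n) : Prop :=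
  A^T = A /\ forall v : 'cV[R]_n, Rle R0 ((v^T *m A *m v) ord0 ord0).

Definition eigenvalue (n : nat) (A : 'M[R]_n) (l : R) : Prop :=
  exists2 v : 'cV[R]_n, v <> 0 & A *m v = l *: v.

Definition is_lambda_max (n : nat) (A : 'M[R]_n) (l : R) : Prop :=
  eigenvalue A l /\ forall m, eigenvalue A m -> Rle m l.
Definition is_lambda_min (n : nat) (A : 'M[R]_n) (l : R) : Prop :=
  eigenvalue A l /\ forall m, eigenvalue A m -> Rle l m.

Definition alpha_conditioned (n : nat) (alpha : R) (Q : 'I_n -> 'M[R]_n) : Prop :=
  (forall i, posdef (Q i)) /\
  forall (i j : 'I_n) (lmax lmin : R),
    is_lambda_max (Q i) lmax -> is_lambda_min (Q j) lmin -> Rle lmax (Rmult alpha lmin).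

Definition doubly_stochastic (n : nat) (Q : 'I_n -> 'M[R]_n) : Prop :=
  [/\ forall i, possemidef (Q i), \sum_(i < n) Q i = 1%:M & forall i, \tr (Q i) = 1].

Definition upd (n : nat) (t : 'I_n -> R) (i : 'I_n) (s : R) : 'I_n -> R :=
  fun j => if j == i then s else t j.

(* mixed_partial F l G : G is the iterated partial derivative of F with respect
   to the variables listed in l (innermost derivative = last element of l),
   the partial derivatives existing at every point of R^n. *)
Fixpoint mixed_partial (n : nat) (F : ('I_n -> R) -> R) (l : seq 'I_n)
    (G : ('I_n -> R) -> R) : Prop :=
  match l with
  | [::] => forall t, G t = F t
  | i :: l' => exists H, mixed_partial F l' H /\
      forall t, derivable_pt_lim (fun s => H (upd t i s)) (t i) (G t)
  end.

Definition det_lin_comb (n : nat) (Q : 'I_n -> 'M[R]_n) (t : 'I_n -> R) : R :=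
  \det (\sum_(i < n) t i *: Q i).

(* D(Q_1,...,Q_n) = d^n/(dt_1...dt_n) det(t_1 Q_1 + ... + t_n Q_n)
   (this derivative is a constant function; we take its value). *)
Definition mixed_discriminant (n : nat) (Q : 'I_n -> 'M[R]_n) : R :=
  epsilon (inhabits R0) (fun d =>
    exists G, mixed_partial (det_lin_comb Q) (enum 'I_n) G /\ forall t, G t = d).

(* Main.v *)
(** Call a family of symmetric matrices P_1, ..., P_n tame if some positive definite B and weights
    c_i > 0 satisfy c_i B <= P_i <= alpha c_i B as quadratic forms. By induction on n, every tame
    family has D(P) <= e^{-(n-1)} e^{alpha (1/2 + ... + 1/n)} det(P_1 + ... + P_n). Both sides scale
    by (det T)^2 under congruence, so one may assume that the P_i sum to I and that the P_i with the
    smallest weight is diagonal, with diagonal d; then D(P) = sum_k d_k D(minors of the other P_j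
    with row and column k deleted). The minors are tame, and their sum is the k-th minor of
    I - diag(d), with determinant prod_{j <> k} (1 - d_j) <= e^{-s + d_k}, where s = sum_j d_j.
    Minimality of the weight gives d_k <= alpha/n, and s e^{-s} <= e^{-1} closes the induction.
    Working with det(P_1 + ... + P_n) in place of doubly stochastic families avoids rescaling after each step.
    The P_i of the theorem are tame because they are multiples of a single congruence of
    alpha-conditioned forms, so the bound n^alpha e^{-(n-1)} holds, and alpha <= alpha^4. *)

Require Import Defs.
From HB Require Import structures.
From Stdlib Require Import Reals ClassicalEpsilon FunctionalExtensionality.
From mathcomp Require Import all_boot all_order all_fingroup all_algebra ring lra.

Set Implicit Arguments.
Unset Strict Implicit.
Unset Printing Implicit Defensive.

Import Order.TTheory GRing.Theory Num.Theory.
Local Open Scope ring_scope.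

(** * The order structure on the reals *)

Definition Rleb (x y : R) : bool := Rle_dec x y.
Definition Rltb (x y : R) : bool := (y != x) && Rleb x y.

Fact Rleb_reflect (x y : R) : reflect (Rle x y) (Rleb x y).
Proof. by rewrite /Rleb; apply: (iffP idP); case: Rle_dec. Qed.

Fact Rleb0_add (x y : R) : Rleb 0 x -> Rleb 0 y -> Rleb 0 (x + y).
Proof. by move=> /Rleb_reflect ? /Rleb_reflect ?; apply/Rleb_reflect/Rplus_le_le_0_compat. Qed.

Fact Rleb0_mul (x y : R) : Rleb 0 x -> Rleb 0 y -> Rleb 0 (x * y).
Proof. by move=> /Rleb_reflect ? /Rleb_reflect ?; apply/Rleb_reflect/Rmult_le_pos. Qed.

Fact Rleb0_anti (x : R) : Rleb 0 x -> Rleb x 0 -> x = 0.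
Proof. by move=> /Rleb_reflect ? /Rleb_reflect ?; apply: Rle_antisym. Qed.

Fact Rleb_sub_ge0 (x y : R) : Rleb 0 (y - x) = Rleb x y.
Proof.
by apply/Rleb_reflect/Rleb_reflect => /Rle_ge H; apply: Rge_le;
   [exact: Rminus_ge H | exact: Rge_minus H].
Qed.

Fact Rleb0_total (x : R) : Rleb 0 x || Rleb x 0.
Proof.
by apply/orP; case: (Rle_dec 0 x) => [H|/Rnot_le_lt/Rlt_le H]; [left|right]; apply/Rleb_reflect.
Qed.

Fact RabsN (x : R) : Rabs (- x) = Rabs x. Proof. exact: Rabs_Ropp. Qed.

Fact Rabs_ge0_id (x : R) : Rleb 0 x -> Rabs x = x.
Proof. by move/Rleb_reflect/Rabs_pos_eq. Qed.

Fact Rltb_def (x y : R) : Rltb x y = (y != x) && Rleb x y. Proof. by []. Qed.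

HB.instance Definition _ := Num.IntegralDomain_isLeReal.Build R
  Rleb0_add Rleb0_mul Rleb0_anti Rleb_sub_ge0 Rleb0_total RabsN Rabs_ge0_id Rltb_def.

Lemma RleP (x y : R) : reflect (Rle x y) (x <= y).
Proof. exact: Rleb_reflect. Qed.

Lemma RltP (x y : R) : reflect (Rlt x y) (x < y).
Proof.
rewrite lt_neqAle; apply: (iffP andP) => [[/eqP ne /RleP le]|lt].
  by case: le.
by split; [apply/eqP/Rlt_not_eq|apply/RleP/Rlt_le].
Qed.

(** * Quadratic forms *)

Definition bilin n (A : 'M[R]_n) (u v : 'cV[R]_n) : R := (u^T *m A *m v) ord0 ord0.

Notation qform A v := (bilin A v v).

Section Forms.

Variable n : nat.
Implicit Types (A B S : 'M[R]_n) (u v w : 'cV[R]_n).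

Lemma bilinDr A u v w : bilin A u (v + w) = bilin A u v + bilin A u w.
Proof. by rewrite /bilin mulmxDr mxE. Qed.

Lemma bilinDl A u v w : bilin A (v + w) u = bilin A v u + bilin A w u.
Proof. by rewrite /bilin linearD !mulmxDl mxE. Qed.

Lemma bilinZr A u v (a : R) : bilin A u (a *: v) = a * bilin A u v.
Proof. by rewrite /bilin -scalemxAr mxE. Qed.

Lemma bilinZl A u v (a : R) : bilin A (a *: u) v = a * bilin A u v.
Proof. by rewrite /bilin linearZ -!scalemxAl mxE. Qed.

Lemma bilinDm A B u v : bilin (A + B) u v = bilin A u v + bilin B u v.
Proof. by rewrite /bilin mulmxDr mulmxDl mxE. Qed.

Lemma bilinZm A u v (a : R) : bilin (a *: A) u v = a * bilin A u v.
Proof. by rewrite /bilin -scalemxAr -scalemxAl mxE. Qed.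

Lemma bilinNm A u v : bilin (- A) u v = - bilin A u v.
Proof. by rewrite -scaleN1r bilinZm mulN1r. Qed.

Lemma bilin_summ (I : finType) (p : pred I) (F : I -> 'M[R]_n) u v :
  bilin (\sum_(i | p i) F i) u v = \sum_(i | p i) bilin (F i) u v.
Proof. by rewrite /bilin mulmx_sumr mulmx_suml summxE. Qed.

Lemma bilinC A u v : A^T = A -> bilin A u v = bilin A v u.
Proof.
move=> sA; rewrite /bilin.
have -> : u^T *m A *m v = (v^T *m A *m u)^T by rewrite !trmx_mul trmxK sA mulmxA.
by rewrite mxE.
Qed.

Lemma qform1E v : qform 1%:M v = \sum_i v i ord0 ^+ 2.
Proof. by rewrite /bilin mulmx1 mxE; apply: eq_bigr => i _; rewrite !mxE -expr2. Qed.

Lemma qform1_ge0 v : 0 <= qform 1%:M v.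
Proof. by rewrite qform1E sumr_ge0 // => i _; rewrite sqr_ge0. Qed.

Lemma qform1_gt0 v : v != 0 -> 0 < qform 1%:M v.
Proof.
move=> v0; rewrite lt_def qform1_ge0 andbT; apply: contraNneq v0.
rewrite qform1E => /eqP; rewrite psumr_eq0 => [|i _]; last by rewrite sqr_ge0.
move/allP => h; apply/eqP/colP => i; rewrite mxE; apply/eqP.
by have := h i (mem_index_enum _); rewrite sqrf_eq0.
Qed.

Lemma bilin_delta A i j : bilin A (delta_mx i ord0) (delta_mx j ord0) = A i j.
Proof. by rewrite /bilin trmx_delta -rowE -colE !mxE. Qed.

Lemma qformE A v : qform A v = \sum_j \sum_i A i j * (v i ord0 * v j ord0).
Proof.
rewrite /bilin mxE; apply: eq_bigr => j _; rewrite mxE mulr_suml.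
by apply: eq_bigr => i _; rewrite mxE; ring.
Qed.

Lemma qform_bounded A : exists2 M : R, 0 < M & forall v, `|qform A v| <= M * qform 1%:M v.
Proof.
(* The summand 1 keeps the constant positive when [A] is zero, so that it can be inverted later. *)
exists (1 + \sum_j \sum_i `|A i j|) => [|v].
  by apply: ltr_pwDl => //; apply: sumr_ge0 => j _; apply: sumr_ge0 => i _; exact: normr_ge0.
apply: (@le_trans _ _ ((\sum_j \sum_i `|A i j|) * qform 1%:M v)); last first.
  by rewrite ler_wpM2r ?qform1_ge0 // lerDr.
rewrite qformE mulr_suml; apply: le_trans (ler_norm_sum _ _ _) _.
apply: ler_sum => j _; rewrite mulr_suml; apply: le_trans (ler_norm_sum _ _ _) _.
apply: ler_sum => i _; rewrite normrM ler_wpM2l //.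
have sq k : `|v k ord0| ^+ 2 <= qform 1%:M v.
  rewrite real_normK ?num_real // qform1E (bigD1 k) //= lerDl sumr_ge0 // => l _.
  by rewrite sqr_ge0.
(* Both squares are at most [qform 1%:M v], and [a * b] is at most half their sum. *)
have := sq i; have := sq j; rewrite normrM; set a := `|v i _|; set b := `|v j _|.
have := sqr_ge0 (a - b); nra.
Qed.

(* Expand [qform B (t v - B^-1 v) >= 0] with [t] an upper bound of [B^-1]. *)
Lemma psd_unit_coercive B : B^T = B -> (forall v, 0 <= qform B v) -> B \in unitmx ->
  exists2 e : R, 0 < e & forall v, e * qform 1%:M v <= qform B v.
Proof.
move=> sB pB uB; have [M M0 hM] := qform_bounded (invmx B).
exists M^-1 => [|v]; first by rewrite invr_gt0.
pose w := invmx B *m v.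
have Bvw : bilin B v w = qform 1%:M v by rewrite /bilin /w mulmx1 mulmxA mulmxK.
have Bww : qform B w = qform (invmx B) v.
  rewrite /bilin /w trmx_mul trmx_inv sB mulmxA mulmxKV //.
have := pB (M *: v + (-1) *: w).
rewrite !(bilinDl, bilinDr, bilinZl, bilinZr) (bilinC w v sB) Bvw Bww => h.
have := ler_normlW (hM v); set x := qform (invmx B) v in h *.
move=> hx; rewrite ler_pdivrMl //.
rewrite -(ler_pM2l M0); lra.
Qed.

Lemma posdefP S : posdef S <-> S^T = S /\ forall v, v != 0 -> 0 < qform S v.
Proof.
split=> -[sS h]; split=> // v v0; first by apply/RltP/h/eqP.
by apply/RltP/h/eqP.
Qed.

Lemma posdef_qform_ge0 S v : posdef S -> 0 <= qform S v.
Proof.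
move=> /posdefP[_ h]; have [->|/h/ltW //] := eqVneq v 0.
by rewrite /bilin mulmx0 mxE.
Qed.

Lemma notin_unitmx_ker A : A \notin unitmx -> exists2 w : 'cV[R]_n, w != 0 & A *m w = 0.
Proof.
rewrite -unitmx_tr -row_free_unit -kermx_eq0 => /rowV0Pn[u /sub_kermxP uA u0].
exists u^T; first by rewrite -trmx0 (inj_eq trmx_inj).
by rewrite -[A]trmxK -trmx_mul uA trmx0.
Qed.

Lemma posdef_unitmx S : posdef S -> S \in unitmx.
Proof.
move=> /posdefP[_ h]; apply: contraT => /notin_unitmx_ker[w /h + Sw].
by rewrite /bilin -mulmxA Sw mulmx0 mxE ltxx.
Qed.

Lemma posdef_coercive S : posdef S ->
  exists2 e : R, 0 < e & forall v, e * qform 1%:M v <= qform S v.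
Proof.
move=> pS; apply: psd_unit_coercive; last exact: posdef_unitmx.
  by case: pS.
by move=> v; apply: posdef_qform_ge0.
Qed.

End Forms.

(* The infimum of [A] relative to [S] is attained: otherwise [A - l S] would be coercive at the
   supremum [l] of the lower bounds, which could then be increased. *)
Lemma min_generalized_eigenvalue n (S A : 'M[R]_n.+1) : posdef S -> A^T = A ->
  exists l : R, (exists2 w : 'cV[R]_n.+1, w != 0 & A *m w = l *: (S *m w)) /\
    forall v, l * qform S v <= qform A v.
Proof.
move=> pS sA.
pose E (l : R) := forall v, l * qform S v <= qform A v.
have [MA MA0 hMA] := qform_bounded A.
have [MS MS0 hMS] := qform_bounded S.
have [e e0 he] := posdef_coercive pS.
have Ene : E (- (MA / e)).
  move=> v; have := hMA v; have := he v; rewrite ler_norml => h1 /andP[h2 _].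
  apply: le_trans h2; rewrite mulNr lerN2 -mulrA ler_pM2l //.
  by rewrite ler_pdivlMl.
have Ebd : bound E.
  pose d := (delta_mx ord0 ord0 : 'cV[R]_n.+1).
  have Sd : 0 < qform S d.
    case/posdefP: pS => _; apply; apply/eqP => /colP/(_ ord0)/eqP.
    by rewrite !mxE !eqxx oner_eq0.
  exists (qform A d / qform S d) => l /(_ d); rewrite -ler_pdivlMr //.
  by move/RleP.
have [l [lub ll]] := completeness E Ebd (ex_intro _ _ Ene).
have El : E l.
  move=> v; have [v0|v0] := eqVneq v 0; first by rewrite v0 /bilin !mulmx0 !mxE mulr0.
  have Sv : 0 < qform S v by case/posdefP: pS => _; apply.
  rewrite -ler_pdivlMr //; apply/RleP/ll => k /(_ v).
  by rewrite -ler_pdivlMr // => /RleP.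
exists l; split=> //.
pose B := A + (- l) *: S.
have qB v : qform B v = qform A v - l * qform S v by rewrite bilinDm bilinZm mulNr.
have sB : B^T = B by rewrite /B linearD linearZ /= sA; case: pS => ->.
case: (boolP (B \in unitmx)) => [uB|/notin_unitmx_ker[w w0 Bw]]; last first.
  exists w => //; apply/eqP; rewrite -subr_eq0 -scaleNr scalemxAl -mulmxDl.
  by rewrite -/B Bw.
have [d d0 hd] : exists2 d : R, 0 < d & forall v, d * qform 1%:M v <= qform B v.
  by apply: psd_unit_coercive => // v; rewrite qB subr_ge0; apply: El.
(* [qform S] is at most [MS] times the Euclidean form, so coercivity of [B] with constant [d] leaves
   room to raise [l] by [d / MS]. *)
have : E (l + d / MS).
  move=> v; have := hd v; rewrite qB mulrDl => h.
  have h2 := ler_normlW (hMS v).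
  rewrite -lerBrDl; apply: le_trans h; rewrite -mulrA ler_pM2l //.
  by rewrite ler_pdivrMl.
move=> /lub/RleP; rewrite gerDl leNgt divr_gt0 //.
Qed.

(** * Congruence and simultaneous diagonalization of two forms *)

Lemma bilin_congr m n (A : 'M[R]_m) (T : 'M[R]_(m, n)) u v :
  bilin (T^T *m A *m T) u v = bilin A (T *m u) (T *m v).
Proof. by rewrite /bilin trmx_mul !mulmxA. Qed.

Lemma sym_congr m n (A : 'M[R]_m) (T : 'M[R]_(m, n)) :
  A^T = A -> (T^T *m A *m T)^T = T^T *m A *m T.
Proof. by move=> sA; rewrite !trmx_mul trmxK sA mulmxA. Qed.

Lemma posdef_congr m n (A : 'M[R]_m) (T : 'M[R]_(m, n)) :
  (forall v : 'cV[R]_n, v != 0 -> T *m v != 0) -> posdef A -> posdef (T^T *m A *m T).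
Proof.
move=> injT /posdefP[sA pA]; apply/posdefP; split; first exact: sym_congr.
by move=> v v0; rewrite bilin_congr pA ?injT.
Qed.

Lemma unitmx_mul_neq0 n (T : 'M[R]_n) (v : 'cV[R]_n) : T \in unitmx -> v != 0 -> T *m v != 0.
Proof. by move=> uT; apply: contraNneq => Tv; rewrite -[v](mulKmx uT) Tv mulmx0. Qed.

(** In the rank factorization of a nonzero column the right factor is a 1 x 1 unit [c], so [c] times
    the left factor has [w] as its first column. *)
Lemma unitmx_col_completion n (w : 'cV[R]_n.+1) : w != 0 ->
  exists2 M : 'M[R]_n.+1, M \in unitmx & M *m delta_mx ord0 ord0 = w.
Proof.
move=> w0; pose c := row_ebase w ord0 ord0.
have r1 : \rank w = 1%N.
  by apply/eqP; rewrite eqn_leq rank_leq_col lt0n mxrank_eq0.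
have rE : row_ebase w = c%:M by rewrite [row_ebase w]mx11_scalar.
have c0 : c \is a GRing.unit.
  by have := row_ebase_unit w; rewrite rE unitmxE det_scalar1.
exists (c *: col_ebase w); first by rewrite unitmxZ // col_ebase_unit.
rewrite -[RHS]mulmx_ebase r1 rE -scalemxAl mul_mx_scalar; congr (_ *: (_ *m _)).
by apply/colP => i; rewrite !mxE eqxx andbT /=; case: (i =P ord0) => [->|/eqP]//; case: i => -[].
Qed.

(** One step of symmetric Gaussian elimination. The matrix [N] depends on [b] but not on [l], so a
    single [N] serves two forms whose first rows are proportional, even when [l] is zero. *)
Lemma block_elimination n (T : 'M[R]_(1 + n)) (l : R) (b : 'rV[R]_n) : T^T = T ->
  ulsubmx T = l%:M -> ursubmx T = l *: b ->
  let N := block_mx 1%:M (- b) 0 1%:M in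
  exists T' : 'M[R]_n, N^T *m T *m N = block_mx l%:M 0 0 T'.
Proof.
move=> sT eul eur N; exists (drsubmx T - l *: (b^T *m b)).
have edl : dlsubmx T = l *: b^T by rewrite -[T]sT -trmx_ursub eur linearZ.
rewrite -[T]submxK eul eur edl /N tr_block_mx !trmx1 trmx0 linearN /= !mulmx_block.
rewrite !mulmx0 !mul0mx !mulmx1 !mul1mx !addr0.
rewrite !mulNmx !mulmxN mul_mx_scalar mul_scalar_mx -?scalemxAr -?scalemxAl.
rewrite !addNr mul0mx oppr0 !add0r; congr block_mx.
by rewrite block_mxKdr addrC.
Qed.

(** Take an [S]-normalized generalized eigenvector as first basis vector. The first row of [A] is
    then [l] times that of [S], one elimination splits a 1 x 1 block off both forms, and induction
    handles the rest. *)
Lemma simultaneous_diagonalization n (S A : 'M[R]_n) : posdef S -> A^T = A ->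
  exists2 T : 'M[R]_n, T \in unitmx &
    T^T *m S *m T = 1%:M /\ exists d : 'rV[R]_n, T^T *m A *m T = diag_mx d.
Proof.
elim: n S A => [|n IHn] S A pS sA.
  exists 1%:M; first exact: unitmx1.
  by split; [|exists 0]; apply/matrixP => -[].
have [l [[w0 w0n0 Aw0] _]] := min_generalized_eigenvalue pS sA.
have qw0 : 0 < qform S w0 by case/posdefP: pS => _; apply.
have [w [wn0 Aw qw]] : exists w, [/\ w != 0, A *m w = l *: (S *m w) & qform S w = 1].
  pose r := sqrt (qform S w0).
  have r2 : r * r = qform S w0 by apply: sqrt_sqrt; apply/RleP/ltW.
  have rn0 : r != 0 by apply: contraTneq qw0; rewrite -r2 => ->; rewrite mulr0 ltxx.
  exists (r^-1 *: w0); split.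
  - by rewrite scaler_eq0 invr_eq0 (negPf rn0).
  - by rewrite -!scalemxAr Aw0 !scalerA mulrC.
  - by rewrite bilinZl bilinZr -r2; field.
have [M uM Mw] := unitmx_col_completion wn0.
pose S1 : 'M[R]_(1 + n) := M^T *m S *m M; pose A1 : 'M[R]_(1 + n) := M^T *m A *m M.
have sS1 : S1^T = S1 by apply: sym_congr; case: pS.
have sA1 : A1^T = A1 by apply: sym_congr.
have S100 : S1 ord0 ord0 = 1 by rewrite -bilin_delta bilin_congr Mw.
have A1S1 i : A1 i ord0 = l * S1 i ord0.
  by rewrite -!bilin_delta !bilin_congr Mw /bilin -!mulmxA Aw -!scalemxAr mxE.
have A1S1r j : A1 ord0 j = l * S1 ord0 j.
  have symE (X : 'M[R]_(1 + n)) i k : X^T = X -> X i k = X k i by move=> {1}<-; rewrite mxE.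
  by rewrite (symE A1) // (symE S1).
pose b := ursubmx S1.
have l0 : lshift n (@ord0 0) = ord0 by apply: val_inj.
have ulE (X : 'M[R]_(1 + n)) : ulsubmx X = (X ord0 ord0)%:M.
  by rewrite [LHS]mx11_scalar !mxE l0.
have S1ul : ulsubmx S1 = 1%:M by rewrite ulE S100.
have A1ul : ulsubmx A1 = l%:M by rewrite ulE A1S1 S100 mulr1.
have A1ur : ursubmx A1 = l *: b.
  have urE (X : 'M[R]_(1 + n)) j : ursubmx X ord0 j = X ord0 (rshift 1 j).
    by rewrite !mxE l0.
  by apply/rowP => j; rewrite [RHS]mxE !urE A1S1r.
pose N : 'M[R]_(1 + n) := block_mx 1%:M (- b) 0 1%:M.
have [S' eS'] : exists S' : 'M[R]_n, N^T *m S1 *m N = block_mx 1%:M 0 0 S'.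
  by apply: block_elimination; rewrite ?scale1r.
have [A' eA'] : exists A' : 'M[R]_n, N^T *m A1 *m N = block_mx l%:M 0 0 A'.
  exact: block_elimination.
have uN : N \in unitmx by rewrite unitmxE /N det_ublock !det1 mulr1 unitr1.
(* The lower block is itself a congruence of the whole matrix, by the inclusion of the last [n]
   coordinates; it inherits symmetry and positive definiteness. *)
have dr (X : 'M[R]_(1 + n)) x X' : X = block_mx x 0 0 X' ->
    X' = (col_mx 0 1%:M)^T *m X *m col_mx 0 1%:M.
  by move=> ->; rewrite tr_col_mx trmx0 trmx1 mul_row_block !mul0mx mulmx0 !mul1mx !add0r
     mul_row_col mul0mx mulmx1 add0r.
have sA' : A'^T = A' by rewrite (dr _ _ _ eA'); do 2!apply: sym_congr.
have pS' : posdef S'.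
  rewrite (dr _ _ _ eS'); apply: posdef_congr.
    move=> v; apply: contraNneq; rewrite mul_col_mx mul0mx mul1mx => v0.
    by rewrite -[v](col_mxKd (0 : 'cV[R]_1)) v0 linear0.
  by apply: posdef_congr => [v|]; [|apply: posdef_congr => // v]; apply: unitmx_mul_neq0.
have [T' uT' [TS [d TA]]] := IHn _ _ pS' sA'.
pose L : 'M[R]_(1 + n) := block_mx 1%:M 0 0 T'.
have uL : L \in unitmx by rewrite unitmxE /L det_ublock det1 mul1r -unitmxE.
exists (M *m N *m L); first by rewrite !unitmx_mul uM uN.
have congrL x X : L^T *m block_mx x 0 0 X *m L = block_mx x 0 0 (T'^T *m X *m T').
  by rewrite /L tr_block_mx !trmx0 trmx1 !mulmx_block !(mulmx0, mul0mx, mul1mx, mulmx1, addr0, add0r).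
have assoc X : (M *m N *m L)^T *m X *m (M *m N *m L) = L^T *m (N^T *m (M^T *m X *m M) *m N) *m L.
  by rewrite !trmx_mul !mulmxA.
split; first by rewrite assoc eS' congrL TS -scalar_mx_block.
exists (row_mx l%:M d); rewrite assoc eA' congrL TA; symmetry.
apply: etrans (@diag_mx_row R n 1 _ _) _; congr block_mx.
by apply/matrixP => i j; rewrite !ord1 !mxE.
Qed.

(** * The mixed discriminant as a sum of determinants *)

(** [mixed_discriminant] is chosen by [epsilon]; uniqueness of iterated derivatives is what pins its
    value down. *)
Lemma mixed_partial_unique n (F : ('I_n -> R) -> R) l G H :
  mixed_partial F l G -> mixed_partial F l H -> G =1 H.
Proof.
elim: l G H => [|i l IHl] G H /=; first by move=> eG eH t; rewrite eG eH.
move=> [G' [pG' dG]] [H' [pH' dH]] t; have eGH := IHl _ _ pG' pH'.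
apply: (uniqueness_limite (fun s => G' (upd t i s)) (t i)); first exact: dG.
by have -> : (fun s => G' (upd t i s)) = (fun s => H' (upd t i s))
  by apply: functional_extensionality => s; rewrite eGH.
Qed.

Lemma derivable_pt_lim_sum (I : Type) (r : seq I) (f : I -> R -> R) (f' : I -> R) x :
  (forall i, derivable_pt_lim (f i) x (f' i)) ->
  derivable_pt_lim (fun s => \sum_(i <- r) f i s) x (\sum_(i <- r) f' i).
Proof.
move=> df; elim: r => [|i r IHr].
  rewrite big_nil; have -> : (fun s => \sum_(i <- [::]) f i s) = fct_cte 0.
    by apply: functional_extensionality => s; rewrite big_nil.
  exact: derivable_pt_lim_const.
rewrite big_cons.
have -> : (fun s => \sum_(j <- i :: r) f j s) = plus_fct (f i) (fun s => \sum_(j <- r) f j s).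
  by apply: functional_extensionality => s; rewrite big_cons.
exact: derivable_pt_lim_plus.
Qed.

Lemma derivable_pt_lim_scale (c : R) (f : R -> R) x l :
  derivable_pt_lim f x l -> derivable_pt_lim (fun s => c * f s) x (c * l).
Proof. exact: derivable_pt_lim_scal. Qed.

Lemma derivable_pt_lim_exprn k (x : R) :
  derivable_pt_lim (fun s : R => s ^+ k) x (k%:R * x ^+ k.-1).
Proof.
elim: k => [|k IHk]; first by rewrite mul0r; apply: (derivable_pt_lim_const 1).
have -> : (fun s : R => s ^+ k.+1) = mult_fct Ranalysis1.id (fun s : R => s ^+ k).
  by apply: functional_extensionality => s; rewrite exprS.
have -> : k.+1%:R * x ^+ k = Rplus (Rmult 1 (x ^+ k)) (Rmult x (k%:R * x ^+ k.-1)).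
  rewrite -[LHS]/(k.+1%:R * x ^+ k) -[RHS]/(1 * x ^+ k + x * (k%:R * x ^+ k.-1)).
  rewrite -natr1 mulrDl mul1r addrC; case: k {IHk} => [|k]; first by rewrite !mul0r mulr0.
  by rewrite mulrCA -exprS.
exact: derivable_pt_lim_mult (derivable_pt_lim_id x) IHk.
Qed.

Lemma mixed_partial_scale n (c : R) (F : ('I_n -> R) -> R) l G :
  mixed_partial F l G -> mixed_partial (fun t => c * F t) l (fun t => c * G t).
Proof.
elim: l G => [|i l IHl] G /=; first by move=> e t; rewrite e.
move=> [H [pH dH]]; exists (fun t => c * H t); split; first exact: IHl.
by move=> t; apply: derivable_pt_lim_scale.
Qed.

Lemma mixed_partial_sum n (I : Type) (r : seq I) (F : I -> ('I_n -> R) -> R) l G :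
  (forall i, mixed_partial (F i) l (G i)) ->
  mixed_partial (fun t => \sum_(i <- r) F i t) l (fun t => \sum_(i <- r) G i t).
Proof.
elim: l G => [|k l IHl] G /= pG; first by move=> t; apply: eq_bigr => i _; rewrite pG.
pose H i := proj1_sig (constructive_indefinite_description _ (pG i)).
have pH i : mixed_partial (F i) l (H i) /\
    forall t, derivable_pt_lim (fun s => H i (upd t k s)) (t k) (G i t).
  exact: proj2_sig (constructive_indefinite_description _ (pG i)).
exists (fun t => \sum_(i <- r) H i t); split; first by apply: IHl => i; case: (pH i).
by move=> t; apply: derivable_pt_lim_sum => i; case: (pH i).
Qed.

(** The variables separate: by [uniq l] the factor in [k] has not been differentiated before, and
    all other factors form a constant [c]. *)
Lemma mixed_partial_monomial n (e : 'I_n -> nat) l : uniq l ->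
  mixed_partial (fun t => \prod_i t i ^+ e i) l
    (fun t => \prod_i (if i \in l then (e i)%:R * t i ^+ (e i).-1 else t i ^+ e i)).
Proof.
elim: l => [|k l IHl] //= /andP[kl ul].
eexists; split; first exact: IHl ul.
move=> t; rewrite (bigD1 k) //= mem_head.
pose c := \prod_(i | i != k) (if i \in l then (e i)%:R * t i ^+ (e i).-1 else t i ^+ e i).
have -> : \prod_(i | i != k) (if i \in k :: l then (e i)%:R * t i ^+ (e i).-1 else t i ^+ e i) = c.
  by apply: eq_bigr => i ik; rewrite in_cons (negPf ik).
rewrite mulrC; set f := (fun s : R => _).
have -> : f = (fun s => c * (s ^+ e k)).
  apply: functional_extensionality => s.
  rewrite /f (bigD1 k) //= (negPf kl) /upd eqxx mulrC; congr (_ * _).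
  by apply: eq_bigr => i ik; rewrite (negPf ik).
exact/derivable_pt_lim_scale/derivable_pt_lim_exprn.
Qed.

Lemma mixed_discriminant_eq n (Q : 'I_n -> 'M[R]_n) (d : R) :
  mixed_partial (det_lin_comb Q) (enum 'I_n) (fun=> d) -> mixed_discriminant Q = d.
Proof.
move=> pd; have [|G [pG eG]] := epsilon_spec (inhabits R0)
  (fun d => exists G, mixed_partial (det_lin_comb Q) (enum 'I_n) G /\ forall t, G t = d).
  by exists d, (fun=> d).
by rewrite -(mixed_partial_unique pG pd (fun=> 0)) eG.
Qed.

(** These matrices arise when the determinant of a linear combination is expanded by multilinearity
    in the rows. *)
Definition selected_rows n m (Q : 'I_n -> 'M[R]_m) (f : 'I_m -> 'I_n) : 'M[R]_m :=
  \matrix_(i, j) Q (f i) i j.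

Lemma det_lin_combE n (Q : 'I_n -> 'M[R]_n) t :
  det_lin_comb Q t = \sum_(f : {ffun 'I_n -> 'I_n})
    \det (selected_rows Q f) * \prod_j t j ^+ #|[pred i | f i == j]|.
Proof.
rewrite /det_lin_comb /determinant.
under eq_bigr => s _ do under eq_bigr => i _ do rewrite summxE.
under eq_bigr => s _ do rewrite bigA_distr_bigA big_distrr /=.
rewrite exchange_big; apply: eq_bigr => f _; rewrite mulr_suml; apply: eq_bigr => s _.
rewrite -mulrA; congr (_ * _).
under eq_bigr => i _ do rewrite mxE.
rewrite big_split /= mulrC; congr (_ * _); first by apply: eq_bigr => i _; rewrite mxE.
rewrite (partition_big f predT) //=; apply: eq_bigr => j _.
rewrite -prodr_const; apply: eq_big => [i|i /eqP ->] //.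
Qed.

Lemma mixed_partial_ext n (F F' : ('I_n -> R) -> R) l G G' : F =1 F' -> G =1 G' ->
  mixed_partial F l G -> mixed_partial F' l G'.
Proof.
by move=> /functional_extensionality <-
  /functional_extensionality <-.
Qed.

(** Differentiating once in every variable keeps only the monomial in which each exponent is 1, and
    that one comes from the bijective choices of rows. *)
Lemma det_lin_comb_mixed_partial n (Q : 'I_n -> 'M[R]_n) :
  mixed_partial (det_lin_comb Q) (enum 'I_n)
    (fun=> \sum_(s : 'S_n) \det (selected_rows Q s)).
Proof.
pose D (f : {ffun 'I_n -> 'I_n}) : R := \det (selected_rows Q f).
have pm f := mixed_partial_scale (D f)
  (mixed_partial_monomial (fun j => #|[pred i | f i == j]|) (enum_uniq 'I_n)).
apply: (mixed_partial_ext _ _ (mixed_partial_sum (index_enum {ffun 'I_n -> 'I_n}) pm)) => t.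
  by rewrite det_lin_combE.
rewrite (bigID (fun f : {ffun 'I_n -> 'I_n} => injectiveb f)) /= addrC big1 ?add0r => [|f nf].
  rewrite (reindex (@pval _)) /=; last first.
    pose in_Sn := insubd (1%g : 'S_n).
    by exists in_Sn => /= f Uf; first apply: val_inj; apply: insubdK.
  apply: eq_big => /= [s|s /injectiveP injs]; rewrite ?(valP s) //.
  rewrite big1 ?mulr1 => [|i _].
    by rewrite /D; congr (\det _); apply/matrixP => i j; rewrite !mxE pvalE.
  have -> : #|[pred k | pval s k == i]| = 1%N.
    rewrite -(card1 (s^-1%g i)); apply: eq_card => k; rewrite !inE pvalE.
    by rewrite -[RHS](inj_eq (@perm_inj _ s)) permKV.
  by rewrite mem_enum expr0 mulr1.
(* A non-injective self-map of a finite set misses some [j]; the exponent of [t j] is then 0 and its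
   derivative kills the term. *)
have /existsP[j jf] : [exists j, #|[pred i | f i == j]| == 0%N].
  apply: contraNT nf; rewrite negb_exists => /forallP h.
  have onto j : exists i, f i == j.
    by have /pred0Pn[i fi] := h j; exists i.
  have /image_injP injf : #|image f 'I_n| == #|'I_n|.
    rewrite eqn_leq leq_image_card; apply/subset_leq_card/subsetP => j _.
    by have [i /eqP <-] := onto j; apply: image_f.
  by apply/injectiveP => x y; apply: injf.
by rewrite (bigD1 j) //= mem_enum (eqP jf) !mul0r mulr0.
Qed.


Lemma mixed_discriminantE n (Q : 'I_n -> 'M[R]_n) :
  mixed_discriminant Q = \sum_(s : 'S_n) \det (selected_rows Q s).
Proof. exact/mixed_discriminant_eq/det_lin_comb_mixed_partial. Qed.

Lemma mixed_discriminant_congr n (Q : 'I_n -> 'M[R]_n) (T : 'M[R]_n) :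
  mixed_discriminant (fun i => T^T *m Q i *m T) = \det T ^+ 2 * mixed_discriminant Q.
Proof.
apply: mixed_discriminant_eq.
have := mixed_partial_scale (\det T ^+ 2) (det_lin_comb_mixed_partial Q).
rewrite -mixed_discriminantE; apply: mixed_partial_ext => // t; rewrite /det_lin_comb.
have -> : \sum_i t i *: (T^T *m Q i *m T) = T^T *m (\sum_i t i *: Q i) *m T.
  rewrite mulmx_sumr mulmx_suml; apply: eq_bigr => i _.
  by rewrite -scalemxAr -scalemxAl.
by rewrite !det_mulmx det_tr; ring.
Qed.

(** * Expansion along a diagonal member into principal minors *)

Lemma lift_perm_inj n (i j : 'I_n.+1) : injective (lift_perm i j).
Proof.
move=> s t est; apply/permP => k; apply: (@lift_inj _ j).
by rewrite -!(lift_perm_lift i) est.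
Qed.

(** Removing [i] from the source and [j] from the target leaves an injective self-map of ['I_n],
    hence a permutation. *)
Lemma lift_perm_onto n (i j : 'I_n.+1) (s : 'S_n.+1) : s i = j ->
  exists s', s = lift_perm i j s'.
Proof.
move=> sij.
have /fin_all_exists[f hf] k : exists l, s (lift i k) = lift j l.
  case: (unliftP j (s (lift i k))) => [l ->|]; first by exists l.
  by rewrite -sij => /perm_inj /eqP; rewrite eq_sym (negPf (neq_lift i k)).
have injf : injective f.
  by move=> k l /(congr1 (lift j)); rewrite -!hf => /perm_inj /lift_inj.
exists (perm injf); apply/permP => k; case: (unliftP i k) => [l|] ->.
  by rewrite lift_perm_lift permE hf.
by rewrite lift_perm_id.
Qed.

Definition minor n (k : 'I_n.+1) (A : 'M[R]_n.+1) : 'M[R]_n := row' k (col' k A).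

Lemma sum_perm_fiber (V : zmodType) n (i j : 'I_n.+1) (F : 'S_n.+1 -> V) :
  \sum_(s : 'S_n.+1 | s i == j) F s = \sum_(s : 'S_n) F (lift_perm i j s).
Proof.
rewrite (reindex (lift_perm i j)) /=; last first.
  (* The default [1%g] is never reached, since every [s] in the fiber is a lift. *)
  exists (fun s => odflt 1%g [pick s' | lift_perm i j s' == s]) => s => [_|].
    by case: pickP => [s' /eqP /lift_perm_inj //|/(_ s)]; rewrite eqxx.
  move=> /eqP /lift_perm_onto[s' ->].
  by case: pickP => [s'' /eqP //|/(_ s')]; rewrite eqxx.
by apply: eq_bigl => s; rewrite lift_perm_id eqxx.
Qed.

(** Group the permutations by the row [k] taken from [Q i0]. Its only possibly nonzero entry is the
    diagonal one, so Laplace expansion along it leaves a single cofactor, of sign +1. *)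
Lemma mixed_discriminant_diag n (Q : 'I_n.+1 -> 'M[R]_n.+1) i0 (d : 'rV[R]_n.+1) :
  Q i0 = diag_mx d ->
  mixed_discriminant Q =
    \sum_k d ord0 k * mixed_discriminant (fun i => minor k (Q (lift i0 i))).
Proof.
move=> Qd; rewrite mixed_discriminantE.
rewrite (partition_big (fun s : 'S_n.+1 => s^-1%g i0) predT) //=; apply: eq_bigr => k _.
rewrite (eq_bigl (fun s : 'S_n.+1 => s k == i0)) => [|s]; last first.
  by rewrite -[RHS](inj_eq (@perm_inj _ s^-1%g)) permK eq_sym.
rewrite sum_perm_fiber mixed_discriminantE mulr_sumr; apply: eq_bigr => s _.
rewrite (expand_det_row _ k) (bigD1 k) //= big1 => [|j jk]; last first.
  by rewrite !mxE lift_perm_id Qd mxE eq_sym (negPf jk) mul0r.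
rewrite addr0 mxE lift_perm_id Qd mxE eqxx mulr1n; congr (_ * _).
rewrite /cofactor addnn -signr_odd odd_double mul1r; congr (\det _).
by apply/matrixP => i j; rewrite !mxE lift_perm_lift.
Qed.

(** As congruences by a coordinate inclusion, minors inherit symmetry, positive definiteness and
    inequalities between forms. *)
Lemma minorE n (k : 'I_n.+1) (A : 'M[R]_n.+1) :
  minor k A = (colsub (lift k) 1%:M)^T *m A *m colsub (lift k) 1%:M.
Proof.
rewrite /minor row'Esub col'Esub.
by rewrite trmx_mxsub trmx1 -rowsubE mulmx_colsub mulmx1; apply/matrixP => i j; rewrite !mxE.
Qed.

Lemma colsub_lift_neq0 n (k : 'I_n.+1) (v : 'cV[R]_n) :
  v != 0 -> colsub (lift k) 1%:M *m v != 0.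
Proof.
apply: contraNneq => v0; have : (colsub (lift k) 1%:M)^T *m (colsub (lift k) 1%:M *m v) = 0.
  by rewrite v0 mulmx0.
rewrite mulmxA -[_^T]mulmx1 -minorE.
have -> : minor k 1%:M = 1%:M :> 'M[R]_n.
  by apply/matrixP => i j; rewrite !mxE (inj_eq lift_inj).
by rewrite mul1mx => ->.
Qed.

(** * The inductive estimate *)

(* Otherwise the arguments of [exp] and [ln] are parsed in [R_scope]. *)
Arguments exp x%_ring_scope.
Arguments ln x%_ring_scope.

Lemma exp_add (x y : R) : exp (x + y) = exp x * exp y.
Proof. exact: exp_plus. Qed.

Lemma expN (x : R) : exp (- x) = (exp x)^-1.
Proof. exact: exp_Ropp. Qed.

Lemma exp_gt0 (x : R) : 0 < exp x.
Proof. exact/RltP/exp_pos. Qed.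

Lemma ler_exp (x y : R) : x <= y -> exp x <= exp y.
Proof. by rewrite le_eqVlt => /predU1P[->//|/RltP/exp_increasing/RltP/ltW]. Qed.

Lemma exp_ge1D (x : R) : 1 + x <= exp x.
Proof. exact/RleP/exp_ineq1_le. Qed.

Lemma exp_sum (I : finType) (F : I -> R) : exp (\sum_i F i) = \prod_i exp (F i).
Proof. by apply: (big_morph exp exp_add); apply: exp_0. Qed.

(** Equivalent to [s <= exp (s - 1)], the tangent line bound at 1. *)
Lemma mul_expN_le (s : R) : s * exp (- s) <= exp (- 1).
Proof.
rewrite -ler_pdivlMr ?exp_gt0 // -expN opprK -exp_add.
by apply: le_trans (exp_ge1D _); rewrite addrA subrr add0r.
Qed.

(* Shifted index: [discriminant_bound alpha n] is the constant for [n + 1] matrices. *)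
Definition discriminant_bound (alpha : R) (n : nat) : R :=
  \prod_(i < n) exp (alpha / i.+2%:R - 1).

Lemma discriminant_bound_gt0 alpha n : 0 < discriminant_bound alpha n.
Proof. by apply: prodr_gt0 => i _; apply: exp_gt0. Qed.

(** Evaluate at the [k]-th basis vector [e]. The [n.+1] values [qform (P i) e] sum to 1 and each is
    at least [c i0 * qform B e], so the latter is at most [1 / n.+1]; the entry [d_k] is at most
    [alpha] times it. *)
Lemma small_member_diag n (alpha : R) (P : 'I_n.+1 -> 'M[R]_n.+1) (B : 'M[R]_n.+1)
    (c : 'I_n.+1 -> R) (i0 : 'I_n.+1) (d : 'rV[R]_n.+1) :
  0 <= alpha -> posdef B -> (forall i, 0 < c i) -> (forall i, c i0 <= c i) ->
  (forall i v, c i * qform B v <= qform (P i) v <= alpha * (c i * qform B v)) ->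
  \sum_i P i = 1%:M -> P i0 = diag_mx d ->
  forall k, 0 <= d ord0 k <= 1 /\ d ord0 k <= alpha / n.+1%:R.
Proof.
move=> a0 pB c0 minc hP sumP Pd k.
pose e : 'cV[R]_n.+1 := delta_mx k ord0.
have B0 : 0 <= qform B e by apply: posdef_qform_ge0.
have P0 i : 0 <= qform (P i) e.
  by case/andP: (hP i e) => + _; apply: le_trans; apply: mulr_ge0 => //; apply: ltW.
have sume : \sum_i qform (P i) e = 1 by rewrite -bilin_summ sumP bilin_delta mxE eqxx.
have dk : qform (P i0) e = d ord0 k by rewrite Pd bilin_delta mxE eqxx.
split.
  rewrite -dk P0 /= -[leRHS]sume (bigD1 i0) //= lerDl; apply: sumr_ge0 => i _; exact: P0.
rewrite -dk; case/andP: (hP i0 e) => _ /le_trans; apply; rewrite ler_wpM2l //.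
rewrite -div1r ler_pdivlMr ?ltr0n // -[leRHS]sume.
apply: (@le_trans _ _ (\sum_(i < n.+1) c i0 * qform B e)).
  by rewrite sumr_const card_ord mulr_natr.
apply: ler_sum => i _; case/andP: (hP i e) => + _; apply: le_trans.
by rewrite ler_wpM2r.
Qed.

Lemma minor_diag n (k : 'I_n.+1) (d : 'rV[R]_n.+1) :
  minor k (1%:M - diag_mx d) = diag_mx (\row_j (1 - d ord0 (lift k j))).
Proof.
apply/matrixP => i j; rewrite !mxE (inj_eq lift_inj).
by case: eqP => _; rewrite ?mulr1n ?mulr0n ?subr0.
Qed.

(** Apply [1 - x <= exp (- x)] to each factor, nonnegative by hypothesis; [exp (d k)] makes up for
    the skipped index. *)
Lemma prod_1subr_le_exp n (d : 'I_n.+1 -> R) k : (forall j, d j <= 1) ->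
  \prod_j (1 - d (lift k j)) <= exp (d k) * exp (- \sum_j d j).
Proof.
move=> d1; rewrite -exp_add (bigD1_ord k) //= opprD addrA subrr add0r -sumrN exp_sum.
apply: ler_prod => j _; rewrite subr_ge0 d1 /=; exact: exp_ge1D.
Qed.

Lemma mixed_discriminant_le_det n (alpha : R) (P : 'I_n.+1 -> 'M[R]_n.+1) (B : 'M[R]_n.+1)
    (c : 'I_n.+1 -> R) :
  0 <= alpha -> posdef B -> (forall i, 0 < c i) -> (forall i, (P i)^T = P i) ->
  (forall i v, c i * qform B v <= qform (P i) v <= alpha * (c i * qform B v)) ->
  mixed_discriminant P <= discriminant_bound alpha n * \det (\sum_i P i).
Proof.
move=> a0; elim: n P B c => [|n IHn] P B c pB c0 sP hP.
  rewrite mixed_discriminantE /discriminant_bound big_ord0 mul1r big_ord1 det_mx11.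
  rewrite (eq_bigr (fun=> P ord0 ord0 ord0)) => [|s _]; last first.
    by rewrite det_mx11 mxE (ord1 (s ord0)).
  by rewrite sumr_const card_Sn; apply: lexx.
have [i0 _ minc] := arg_minP (i0 := ord0) (P := predT) c isT.
have {}minc i : c i0 <= c i by apply: minc.
pose S := \sum_i P i.
have sS : S^T = S by rewrite /S linear_sum; apply: eq_bigr => i _; exact: sP.
have pS : posdef S.
  apply/posdefP; split=> // v v0; rewrite bilin_summ (bigD1 i0) //=.
  have Bv : 0 < qform B v by case/posdefP: pB => _; apply.
  have Pv i : 0 < qform (P i) v.
    by case/andP: (hP i v) => + _; apply: lt_le_trans; apply: mulr_gt0.
  by apply: ltr_pwDl => //; apply: sumr_ge0 => i _; apply: ltW.
have [T uT [TS [d TP]]] := simultaneous_diagonalization pS (sP i0).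
pose P' i := T^T *m P i *m T; pose B' := T^T *m B *m T.
have detT0 : 0 < \det T ^+ 2.
  by rewrite exprn_even_gt0 //= -unitfE -unitmxE.
have detS : \det T ^+ 2 * \det S = 1.
  by rewrite -[RHS](det1 R n.+2) -TS !det_mulmx det_tr; ring.
(* The congruence by [T] multiplies both sides by [\det T ^+ 2], and [\det T ^+ 2 * \det S] is 1. *)
suff : mixed_discriminant P' <= discriminant_bound alpha n.+1.
  rewrite mixed_discriminant_congr => h.
  by rewrite -(ler_pM2l detT0) mulrCA detS mulr1.
have pB' : posdef B' by apply: posdef_congr => // v; apply: unitmx_mul_neq0.
have sP' i : (P' i)^T = P' i by apply: sym_congr.
have hP' i v : c i * qform B' v <= qform (P' i) v <= alpha * (c i * qform B' v).
  by rewrite !bilin_congr.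
have sumP' : \sum_i P' i = 1%:M by rewrite -TS mulmx_sumr mulmx_suml.
have hd := small_member_diag a0 pB' c0 minc hP' sumP' TP.
rewrite (mixed_discriminant_diag TP).
pose s := \sum_k d ord0 k; pose b := exp (alpha / n.+2%:R).
have minor_le k : mixed_discriminant (fun i => minor k (P' (lift i0 i))) <=
    discriminant_bound alpha n * (b * exp (- s)).
  apply: (@le_trans _ _ (discriminant_bound alpha n *
      \det (\sum_i minor k (P' (lift i0 i))))).
    (* The minors keep the weights of their parents; only that of [i0] is dropped. *)
    apply: (IHn _ (minor k B') (fun i => c (lift i0 i))) => //.
    - by rewrite minorE; apply: posdef_congr => // v; apply: colsub_lift_neq0.
    - by move=> i; rewrite minorE; apply: sym_congr.
    - by move=> i v; rewrite !minorE !bilin_congr.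
  rewrite ler_pM2l ?discriminant_bound_gt0 //.
  have -> : \sum_i minor k (P' (lift i0 i)) = minor k (1%:M - diag_mx d).
    rewrite -sumP' (bigD1_ord i0) //= -TP addrAC subrr add0r minorE.
    by rewrite mulmx_sumr mulmx_suml; apply: eq_bigr => i _; apply: minorE.
  rewrite minor_diag det_diag; under eq_bigr => j _ do rewrite mxE.
  apply: le_trans (prod_1subr_le_exp (d := fun j => d ord0 j) k _) _.
    by move=> j; case: (hd j) => /andP[].
  rewrite ler_pM2r ?exp_gt0 //; apply: ler_exp.
  by case: (hd k).
apply: (@le_trans _ _ (\sum_k d ord0 k * (discriminant_bound alpha n * (b * exp (- s))))).
  by apply: ler_sum => k _; apply: ler_wpM2l => //; case: (hd k) => /andP[].
(* The last factor of the bound splits as [b * exp (- 1)], so [s * exp (- s) <= exp (- 1)]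
   remains. *)
rewrite -mulr_suml -/s /discriminant_bound big_ord_recr /= mulrCA ler_pM2l ?discriminant_bound_gt0 //.
rewrite mulrCA exp_add ler_pM2l ?exp_gt0 //.
exact: mul_expN_le.
Qed.

(** * Harmonic sums against the logarithm *)

(** Exponentiated, this is [1 - x <= exp (- x)] at [x = 1 / n.+2], multiplied by [n.+2]. *)
Lemma ln_succ_sub_ge n : (n.+2%:R : R)^-1 <= ln n.+2%:R - ln n.+1%:R.
Proof.
have p1 : 0 < n.+1%:R :> R by rewrite ltr0n.
have p2 : 0 < n.+2%:R :> R by rewrite ltr0n.
rewrite leNgt; apply/negP; rewrite ltrBlDr addrC -ltrBlDr => /RltP/exp_increasing/RltP.
rewrite exp_add !exp_ln; try exact/RltP.
apply/negP; rewrite -leNgt; have := exp_ge1D (- n.+2%:R^-1).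
rewrite -(ler_pM2l p2); apply: le_trans.
by rewrite mulrDr mulr1 mulrN mulfV ?gt_eqF // -[n.+2%:R]natr1 addrK.
Qed.

(** The logarithms telescope, bounding 1/2 + ... + 1/(n+1) by [ln n.+1%:R]. *)
Lemma discriminant_bound_le alpha n : 0 <= alpha ->
  discriminant_bound alpha n <= exp (alpha * ln n.+1%:R - n%:R).
Proof.
move=> a0; elim: n => [|n IHn].
  rewrite /discriminant_bound big_ord0 subr0.
  have -> : ln 1%:R = 0 by exact: ln_1.
  by rewrite mulr0 exp_0.
rewrite /discriminant_bound big_ord_recr /=.
apply: le_trans (ler_wpM2r (ltW (exp_gt0 _)) IHn) _.
rewrite -exp_add; apply: ler_exp.
have := ler_wpM2l a0 (ln_succ_sub_ge n).
move: (ln _) (ln _) (_^-1) => x y z; rewrite mulrBr -[n.+1%:R]natr1; lra.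
Qed.

(** * Extreme eigenvalues and the passage from conditioning to form bounds *)

Lemma lambda_min_exists n (A : 'M[R]_n.+1) : A^T = A ->
  exists l, is_lambda_min A l /\ forall v, l * qform 1%:M v <= qform A v.
Proof.
have p1 : posdef (1%:M : 'M[R]_n.+1).
  by apply/posdefP; split=> [|v]; [exact: trmx1|exact: qform1_gt0].
move=> sA; have [l [[w w0 Aw] ml]] := min_generalized_eigenvalue p1 sA.
exists l; split=> //; split.
  by exists w; [exact/eqP|rewrite Aw mul1mx].
move=> m [v /eqP v0 Av]; apply/RleP; rewrite -(ler_pM2r (qform1_gt0 v0)).
apply: le_trans (ml v) _.
by rewrite /bilin -mulmxA Av -scalemxAr mxE mulmx1.
Qed.

Lemma lambda_max_exists n (A : 'M[R]_n.+1) : A^T = A ->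
  exists l, is_lambda_max A l /\ forall v, qform A v <= l * qform 1%:M v.
Proof.
move=> sA; have /lambda_min_exists[l [[[w w0 Aw] ml] hl]] : (- A)^T = - A by rewrite linearN /= sA.
exists (- l); split; last by move=> v; have := hl v; rewrite bilinNm mulNr lerNr.
split; first by exists w => //; rewrite scaleNr -Aw mulNmx opprK.
move=> m [v v0 Av]; apply/RleP; rewrite lerNr; apply/RleP/ml.
by exists v => //; rewrite mulNmx Av scaleNr.
Qed.

(** Take [m] to be the least of all the smallest eigenvalues, attained at [j0]; conditioning against
    [j0] bounds every largest eigenvalue by [alpha * m]. *)
Lemma alpha_conditioned_bounds n alpha (Q : 'I_n.+1 -> 'M[R]_n.+1) :
  0 <= alpha -> alpha_conditioned alpha Q ->
  exists2 m : R, 0 < m & forall i v,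
    m * qform 1%:M v <= qform (Q i) v <= alpha * (m * qform 1%:M v).
Proof.
move=> a0 [pQ cQ].
have sQ i : (Q i)^T = Q i by case: (pQ i).
have /fin_all_exists[lmin hmin] i := lambda_min_exists (sQ i).
have /fin_all_exists[lmax hmax] i := lambda_max_exists (sQ i).
have [j0 _ minj] := arg_minP (i0 := ord0) (P := predT) lmin isT.
exists (lmin j0).
  case: (hmin j0) => -[[w /eqP w0 Qw] _] _; have /posdefP[_ /(_ w w0)] := pQ j0.
  rewrite {1}/bilin -mulmxA Qw -scalemxAr mxE -[w^T]mulmx1 pmulr_lgt0 //.
  exact: qform1_gt0.
move=> i v; apply/andP; split.
  case: (hmin i) => _ /(_ v); apply: le_trans; rewrite ler_wpM2r ?qform1_ge0 //.
  exact: minj.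
case: (hmax i) => hi /(_ v) /le_trans; apply; rewrite mulrA ler_wpM2r ?qform1_ge0 //.
by apply/RleP; apply: cQ hi (proj1 (hmin j0)).
Qed.

Theorem theorem1p6 (n : nat) (alpha : R)
  (Q P : 'I_n -> 'M[R]_n) :
  (1 <= n)%N ->
  Rle R1 alpha ->
  alpha_conditioned alpha Q ->
  doubly_stochastic P ->
  (forall i, posdef (P i)) ->
  (exists (T : 'M[R]_n) (tau : 'I_n -> R),
      T \in unitmx /\ (forall i, Rlt R0 (tau i)) /\
      (forall i, P i = (tau i *: (T^T *m Q i *m T))%R)) ->
  Rle (mixed_discriminant P)
      (Rmult (Rpower (INR n) (Rpow_def.pow alpha 4)) (exp (Ropp (Rminus (INR n) R1)))).
Proof.
case: n Q P => // n Q P _ /RleP a1 cQ [_ sumP _] pP [T [tau [uT [tau0 eP]]]].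
have a0 : 0 <= alpha by apply: le_trans a1; apply: ler01.
have [m m0 hm] := alpha_conditioned_bounds a0 cQ.
have tau_gt0 i : 0 < tau i by apply/RltP.
(* All [P i] are compared with this one form; the scalars [tau i] enter only through the weights
   [tau i * m]. *)
pose B := T^T *m 1%:M *m T.
have pB : posdef B.
  apply: posdef_congr => [v|]; first exact: unitmx_mul_neq0.
  by apply/posdefP; split=> [|v]; [exact: trmx1|exact: qform1_gt0].
have hP i v : tau i * m * qform B v <= qform (P i) v <= alpha * (tau i * m * qform B v).
  have /andP[lo hi] := hm i (T *m v).
  rewrite eP bilinZm !bilin_congr -mulrA [alpha * _]mulrCA.
  by rewrite !ler_pM2l // lo.
have c0 i : 0 < tau i * m by apply: mulr_gt0.
have sP i : (P i)^T = P i by case: (pP i).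
have := mixed_discriminant_le_det a0 pB c0 sP hP.
rewrite sumP det1 mulr1 => /le_trans h; apply/RleP; apply: h.
apply: le_trans (discriminant_bound_le n a0) _.
have INRE k : INR k = k%:R :> R.
  by elim: k => [|k IHk] //; rewrite S_INR IHk -natr1.
rewrite exp_add /Rpower INRE.
have -> : Ropp (Rminus n.+1%:R R1) = - n%:R.
  by rewrite -natr1; apply: congr1; apply: addrK.
apply: ler_wpM2r; first exact/ltW/exp_gt0.
(* Raising the exponent from [alpha] to its fourth power is allowed because [ln n.+1%:R] is
   nonnegative and [alpha] is at least 1. *)
apply: ler_exp; apply: ler_wpM2r.
  have ln1 : ln 1 = 0 by exact: ln_1.
  case: (n) => [|k]; first by rewrite ln1.
  rewrite -ln1; apply/RleP/Rlt_le/ln_increasing; first exact: Rlt_0_1.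
  by apply/RltP; rewrite ltr1n.
have -> : Rpow_def.pow alpha 4 = alpha ^+ 4 by rewrite !exprS expr0.
by apply: ler_eXnr.
Qed.
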